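(* Consider a Weitzman-style sequential search process that satisfies Independence and Invariance, with a potentially partially observed action sequence. Suppose the consumer ranks all feasible actions (or composite actions) throughout the sequential search process. Denote the action selected in step $j$ by $a_j$. The process is optimal only if the resulting ranking satisfies: 1. $a_j\succ a_{j+t}$ for all $j$ and all $t\in\mathbb{Z}_{>0}$ such that $a_{j+t}$ is feasible at step $j$; 2. all unselected actions rank lower than the preventive action $\bar a$.
   Context: Weitzman-style sequential search process. A consumer faces a finite set of products. For each product $k$ there are two actions: inspecting it ($I_k$), feasible from the outset, at a search cost $c_k>0$, which reveals its purchase value $u_k$ (the utility from purchasing it; before inspection only its distribution $F_k$ is known); and purchasing it ($P_k$), which is feasible only after $I_k$ has been selected ($I_k$ is the parent action of $P_k$). At each step the consumer selects one currently feasible action, using all information obtained so far; a selected action leaves the feasible set, and the process ends with a purchase. The process is optimal if the consumer's decisions solve the corresponding dynamic program, i.e. maximize the expected utility of the final purchase net of inspection costs. Independence: selecting an action reveals information only about the payoffs of actions that cannot be selected unless that action is selected, and does not alter the information state of payoffs of any other unselected action. Invariance: a feasible action remains feasible at all subsequent stages until it is selected, and its payoff is invariant throughout the entire process. Values and ranking. The value of $P_k$ is $u_k$; the value of $I_k$ is the reservation value $z_k$, the unique solution of $c_k=\int_{z_k}^{\infty}(u-z_k)\,dF_k(u)$. Under Independence and Invariance the optimal policy is the Gittins index policy, which selects at each step the feasible action with the highest value, and the consumer ranks actions by these values ($a\succ b$ means $a$ has the higher value). Partial observability and composite actions. The researcher may observe only part of the action sequence (for example, some selected actions or their order may be unobserved),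 so that the feasibility of some actions at some observed steps cannot be determined. In that case, if the feasibility of a child action such as $P_k$ is undetermined, it is merged with its parent $I_k$ into one composite action $E_k$, which is considered feasible whenever $I_k$ is feasible, is regarded as selected only when $P_k$ is selected, and has value $\min\{z_k,u_k\}$. The steps $j$, the selected actions $a_j$ and the feasible actions in the claim are those of the process recast in this way from the (possibly partially) observed action sequence; with full observation no composite action is needed. An unselected action is one that is feasible at some step but not selected. Forward-accessibility: a step is forward-accessible if any action feasible at that step is selected in a subsequent step (i.e. if at least one such action exists); otherwise it is forward-inaccessible. Preventive action $\bar a$: the lowest-ranked action among all actions selected in forward-inaccessible steps; its value is the minimum value among these selected actions. It is assumed throughout that there are no ties among actions or values. *)

(* Defs.v *)
From HB Require Import structures.
From mathcomp Require Import all_boot all_order all_algebra.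
From mathcomp Require Import all_classical all_reals all_analysis.

Set Implicit Arguments.
Unset Strict Implicit.
Unset Printing Implicit Defensive.

Import Order.TTheory GRing.Theory Num.Theory.
Local Open Scope ring_scope.
Local Open Scope ereal_scope.

Inductive action (T : Type) := Inspect of T | Purchase of T.
Arguments Inspect {T}.
Arguments Purchase {T}.

Definition sum_of_action (T : Type) (a : action T) : T + T :=
  match a with Inspect k => inl k | Purchase k => inr k end.
Definition action_of_sum (T : Type) (a : T + T) : action T :=
  match a with inl k => Inspect k | inr k => Purchase k end.
Lemma sum_of_actionK T : cancel (@sum_of_action T) (@action_of_sum T).
Proof. by case. Qed.

HB.instance Definition _ (T : eqType) :=
  Equality.copy (action T) (can_type (@sum_of_actionK T)).
HB.instance Definition _ (T : choiceType) :=
  Choice.copy (action T) (can_type (@sum_of_actionK T)).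
HB.instance Definition _ (T : countType) :=
  Countable.copy (action T) (can_type (@sum_of_actionK T)).
HB.instance Definition _ (T : finType) :=
  Finite.copy (action T) (can_type (@sum_of_actionK T)).

(* The products inspected so far with their revealed purchase values, oldest
   first. *)
Definition history (R : realType) (T : finType) := seq (T * R).

Definition inspected (R : realType) (T : finType) (h : history R T) : seq T :=
  [seq p.1 | p <- h].

(* The primitives may depend on the history: Independence and Invariance are
   properties an environment may or may not have.  [belief h k] is the law,
   conditional on [h], of the value that inspecting [k] would reveal. *)
Record environment (R : realType) (T : finType) := Environment {
  feasible : history R T -> action T -> bool ;
  cost : history R T -> T -> R ;
  utility : history R T -> T -> R ;
  belief : history R T -> T -> probability (measurableTypeR R) R }.

Section Environment.
Context {R : realType} {T : finType}.
Implicit Types (e : environment R T) (h : history R T) (j k : T).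
Implicit Types (a b : action T) (s : seq (action T)) (u z : T -> R).

(* Finite means make the expected utilities of the dynamic program well
   defined. *)
Record weitzman_style e : Prop := WeitzmanStyle {
  inspect_at_outset : forall k, feasible e [::] (Inspect k) ;
  inspect_once : forall h k,
    k \in inspected h -> ~~ feasible e h (Inspect k) ;
  purchase_after_inspect : forall h k,
    feasible e h (Purchase k) -> k \in inspected h ;
  inspect_enables : forall h k x, feasible e h (Inspect k) ->
    feasible e (rcons h (k, x)) (Purchase k) ;
  inspect_reveals : forall h k x, feasible e h (Inspect k) ->
    utility e (rcons h (k, x)) k = x ;
  cost_gt0 : forall h k, (0 < cost e h k)%R ;
  belief_mean : forall h k,
    (belief e h k).-integrable setT (fun x : measurableTypeR R => x%:E) }.

(* Inspecting [j] is informative only about the payoff of its child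
   [Purchase j]. *)
Definition independence e : Prop :=
  forall h j k (x : R), feasible e h (Inspect j) ->
    k != j -> k \notin inspected h ->
    forall A : set (measurableTypeR R), measurable A ->
      belief e (rcons h (j, x)) k A = belief e h k A.

Definition invariance e : Prop :=
  forall h j (x : R), feasible e h (Inspect j) ->
  [/\ forall a, feasible e h a -> a != Inspect j ->
        feasible e (rcons h (j, x)) a,
      forall k, feasible e h (Inspect k) -> k != j ->
        cost e (rcons h (j, x)) k = cost e h k
    & forall k, feasible e h (Purchase k) ->
        utility e (rcons h (j, x)) k = utility e h k].

Definition action_payoff e (V : history R T -> \bar R) h a : \bar R :=
  match a with
  | Inspect k => \int[belief e h k]_x V (rcons h (k, x)) - (cost e h k)%:E
  | Purchase k => (utility e h k)%:E
  end.

(* Value of the dynamic program when at most [n] further actions can be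
   selected; it is -oo if no purchase can be reached. *)
Fixpoint horizon_value e (n : nat) h : \bar R :=
  if n is n'.+1 then
    \big[maxe/-oo]_(a : action T | feasible e h a)
      action_payoff e (horizon_value e n') h a
  else -oo.

(* At most one inspection per product and the final purchase. *)
Definition dp_value e h : \bar R := horizon_value e (#|T|.+1 - size h) h.

(* [u k] is the realized purchase value of [k], whether or not [k] is
   inspected. *)
Definition history_of u s : history R T :=
  pmap (fun a => if a is Inspect k then Some (k, u k) else None) s.

Definition is_inspect a : bool := if a is Inspect _ then true else false.

Definition search_process e u s : Prop :=
  (forall s1 a s2, s = s1 ++ a :: s2 -> feasible e (history_of u s1) a) /\
  (exists s' k, s = rcons s' (Purchase k) /\ all is_inspect s').

Definition optimal_process e u s : Prop :=
  forall s1 a s2, s = s1 ++ a :: s2 ->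
  forall b, feasible e (history_of u s1) b ->
    action_payoff e (dp_value e) (history_of u s1) b <=
    action_payoff e (dp_value e) (history_of u s1) a.

Definition reservation_value e k (zk : R) : Prop :=
  (cost e [::] k)%:E = \int[belief e [::] k]_(x in `[zk, +oo[%classic) (x - zk)%:E.

Definition action_value z u a : R :=
  match a with Inspect k => z k | Purchase k => u k end.

(* The observation of the researcher: [obs] collects the actions whose
   selection is observed, and [Omega] (an information set) the complete action
   sequences that are compatible with all that the researcher observes.  The
   order of the observed actions is unobserved to the extent that it varies
   across [Omega].  Full observation is [Omega = [set s]], [obs = mem s]. *)
Definition observation e s (Omega : set (seq (action T)))
    (obs : pred (action T)) : Prop :=
  [/\ Omega s,
      forall s', Omega s' -> exists u', search_process e u' s'
    & forall s' a, Omega s' -> obs a -> a \in s'].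

(* Each action occurs at most once in a process, so an observed step is
   designated by the action selected there. *)
Definition precedes s a b : bool := (index a s < index b s)%N.

(* [Purchase k] is known to be feasible at the step of [a] if [Inspect k] is
   observed and is sure to precede [a]; it is known to be infeasible if
   [Inspect k] is sure not to precede [a].  An inspection that is only inferred
   (say, from the purchase) is not located in the observed sequence and thus
   leaves the feasibility of its child undetermined. *)
Definition determined (Omega : set (seq (action T))) (obs : pred (action T))
    k a : Prop :=
  (obs (Inspect k) /\ forall s, Omega s -> precedes s (Inspect k) a) \/
  (forall s, Omega s -> ~~ precedes s (Inspect k) a).

Definition merged (Omega : set (seq (action T))) (obs : pred (action T)) k :
    bool :=
  `[< exists2 a, obs a & ~ determined Omega obs k a >].

End Environment.

(* [Single a] is an original action, [Composite k] merges [Inspect k] and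
   [Purchase k]. *)
Inductive raction (T : Type) := Single of action T | Composite of T.
Arguments Single {T}.
Arguments Composite {T}.

Definition sum_of_raction (T : Type) (a : raction T) : action T + T :=
  match a with Single b => inl b | Composite k => inr k end.
Definition raction_of_sum (T : Type) (a : action T + T) : raction T :=
  match a with inl b => Single b | inr k => Composite k end.
Lemma sum_of_ractionK T : cancel (@sum_of_raction T) (@raction_of_sum T).
Proof. by case. Qed.

HB.instance Definition _ (T : eqType) :=
  Equality.copy (raction T) (can_type (@sum_of_ractionK T)).

Section Recast.
Context {R : realType} {T : finType}.
Implicit Types (M : pred T) (a b : raction T) (r : seq (raction T)) (j t : nat).

Definition recast_action M (a : action T) : option (raction T) :=
  match a with
  | Inspect k => if M k then None else Some (Single (Inspect k))
  | Purchase k => Some (if M k then Composite k else Single (Purchase k))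
  end.

Definition recast M (obs : pred (action T)) (s : seq (action T)) :
    seq (raction T) :=
  pmap (recast_action M) [seq a <- s | obs a].

(* Feasibility at step [j] of the recast sequence [r] (steps numbered from 0).
   In the recast process the parent part of a composite action is never itself
   selected: [Composite k] is feasible from the outset until it is selected. *)
Definition rfeasible M r j a : bool :=
  match a with
  | Single (Inspect k) => ~~ M k && (Single (Inspect k) \notin take j r)
  | Single (Purchase k) =>
      [&& ~~ M k, Single (Inspect k) \in take j r
        & Single (Purchase k) \notin take j r]
  | Composite k => M k && (Composite k \notin take j r)
  end.

Definition unselected M r a : Prop :=
  (exists2 j, (j < size r)%N & rfeasible M r j a) /\ a \notin r.

Definition forward_accessible M r j : Prop :=
  exists2 a, rfeasible M r j a & exists2 t, (0 < t)%N & onth r (j + t) = Some a.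

Definition raction_value (z u : T -> R) a : R :=
  match a with
  | Single b => action_value z u b
  | Composite k => Num.min (z k) (u k)
  end.

Definition outranks (z u : T -> R) a b : Prop :=
  (raction_value z u b < raction_value z u a)%R.

Definition selected_inaccessible M r a : Prop :=
  exists2 j, onth r j = Some a & ~ forward_accessible M r j.

Definition preventive (z u : T -> R) M r a : Prop :=
  selected_inaccessible M r a /\
  forall b, selected_inaccessible M r b -> b <> a -> outranks z u b a.

End Recast.

(* Main.v *)
Require Import Defs.
From mathcomp Require Import all_boot all_order all_algebra.
From mathcomp Require Import all_classical all_reals all_analysis.
From mathcomp Require Import measurable_realfun lra.

(* Independence and Invariance reduce the dynamic program to Weitzman's problem,
   whose state is the set of uninspected products and the best value [y] found.
   The value of a state is E max(y, max_k min(x_k, z_k)): inspecting [k] at cost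
   [c_k = E (x_k - z_k)^+] pays at most what one gets by capping [x_k] at [z_k]
   and inspecting for free, with equality iff no available value exceeds [z_k].
   An optimal process thus selects the highest value at every step.  The two
   claims follow by comparing the recast selections with the actions available
   at the corresponding steps of the complete process. *)

Set Implicit Arguments.
Unset Strict Implicit.
Unset Printing Implicit Defensive.

Import Order.TTheory GRing.Theory Num.Theory.
Local Open Scope ring_scope.

(** * Monotone functions of slope at most one *)

Section Slope.
Context {R : realType}.
Implicit Types (f g : R -> R) (a b x y z : R).

(** State values, as functions of the best value found, lie in this class, which is stable under
    composition, max and min with constants, and means. Monotonicity gives measurability; the slope
    bound gives linear growth, hence integrability under any law with a mean. *)
Definition slope01 f : Prop := forall a b, a <= b -> 0 <= f b - f a <= b - a.

Lemma slope01_id : slope01 id.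
Proof. by move=> a b ab; rewrite subr_ge0 ab lexx. Qed.

Lemma slope01_comp f g : slope01 f -> slope01 g -> slope01 (f \o g).
Proof.
move=> sf sg a b ab; have /andP[g0 g1] := sg _ _ ab.
rewrite subr_ge0 in g0; have /andP[f0 f1] := sf _ _ g0.
by rewrite /= f0 (le_trans f1 g1).
Qed.

Lemma slope01_max y : slope01 (Num.max y).
Proof. by move=> a b ab; case: (leP y a); case: (leP y b); lra. Qed.

Lemma slope01_min z : slope01 (Num.min^~ z).
Proof. by move=> a b ab; case: (leP a z); case: (leP b z); lra. Qed.

Lemma slope01_homo f a b : slope01 f -> a <= b -> f a <= f b.
Proof. by move=> sf /sf; rewrite subr_ge0 => /andP[]. Qed.

Lemma slope01_norm f x : slope01 f -> `|f x| <= `|f 0| + `|x|.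
Proof.
move=> sf; have -> : f x = f 0 + (f x - f 0) by lra.
apply: (le_trans (ler_normD _ _)); rewrite lerD2l.
have [x0|/ltW x0] := leP 0 x; have /andP[] := sf _ _ x0.
- by move=> ? ?; rewrite !ger0_norm//; lra.
- by move=> ? ?; rewrite !ler0_norm//; lra.
Qed.

Lemma slope01_measurable f : slope01 f -> measurable_fun setT (f : R -> R).
Proof.
move=> sf; apply: nondecreasing_measurable => // a b ab.
exact: slope01_homo.
Qed.

End Slope.

(** * Real expectations and their strict comparison *)

Section Mean.
Context d {X : measurableType d} {R : realType} (P : probability X R).
Implicit Types (f g : X -> R).

Notation integ f := (P.-integrable setT (EFin \o f)).
Definition mean f : R := \int[P]_x f x.

Lemma integrable_cst x : integ (cst x).
Proof. exact: finite_measure_integrable_cst. Qed.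

Lemma meanE f : integ f -> (\int[P]_x (f x)%:E = (mean f)%:E)%E.
Proof. by move=> fi; rewrite /mean /Rintegral fineK// integrable_fin_num. Qed.

Lemma mean_cst x : mean (cst x) = x.
Proof. by rewrite /mean Rintegral_cst//= probability_setT mulr1. Qed.

Lemma meanD f g : integ f -> integ g -> mean (f \+ g) = mean f + mean g.
Proof. by move=> fi gi; rewrite /mean RintegralD. Qed.

Lemma meanB f g : integ f -> integ g -> mean (f \- g) = mean f - mean g.
Proof. by move=> fi gi; rewrite /mean RintegralB. Qed.

Lemma le_mean f g : integ f -> integ g -> (forall x, f x <= g x) ->
  mean f <= mean g.
Proof. by move=> fi gi fg; apply: le_Rintegral. Qed.

Lemma mean_eq0 f g : integ f -> integ g ->
  (forall x, 0 <= f x) -> (forall x, f x = 0 -> g x = 0) ->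
  mean f = 0 -> mean g = 0.
Proof.
move=> fi gi f0 fg mf0.
suff : (\int[P]_x (g x)%:E = 0)%E by rewrite meanE// => -[].
have : (\int[P]_x `|(f x)%:E| = 0)%E.
  by under eq_integral do rewrite gee0_abs ?lee_fin//; rewrite meanE// mf0.
have mf : measurable_fun setT (EFin \o f) by case/integrableP : fi.
have mg : measurable_fun setT (EFin \o g) by case/integrableP : gi.
move=> /(ae_eq_integral_abs _ measurableT mf) ae0.
rewrite -[RHS](integral0 P setT); apply: ae_eq_integral => //.
by apply: filterS ae0 => x fx0 _; move: (fx0 I) => -[/fg] /= ->.
Qed.

(** Here [g] witnesses strictness: if the means agreed, [f2 - f1] would vanish almost everywhere,
    hence so would [g], against its nonzero mean. *)
Lemma lt_mean f1 f2 g : integ f1 -> integ f2 -> integ g ->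
  (forall x, f1 x <= f2 x) -> (forall x, f1 x = f2 x -> g x = 0) ->
  mean g != 0 -> mean f1 < mean f2.
Proof.
move=> i1 i2 gi f12 fg; apply: contraNT; rewrite -leNgt => m21.
apply/eqP; apply: (@mean_eq0 (f2 \- f1) g) => //.
- rewrite (_ : _ \o _ = (EFin \o f2) \- (EFin \o f1))%E//.
  exact: integrableB.
- by move=> x; rewrite subr_ge0.
- by move=> x /eqP; rewrite subr_eq0 => /eqP/esym/fg.
- rewrite meanB//; apply/eqP.
  by rewrite subr_eq0 eq_le m21 le_mean.
Qed.

End Mean.

(** * Means of slope-one functions under a law on the reals *)

Section MeanReal.
Context {R : realType} (P : probability (measurableTypeR R) R).
Hypothesis Pmean : P.-integrable setT (fun x : measurableTypeR R => x%:E).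

Lemma integrable_slope01 (f : measurableTypeR R -> R) : slope01 (f : R -> R) ->
  P.-integrable setT (EFin \o f).
Proof.
move=> sf.
apply: (@le_integrable _ _ _ P setT measurableT _
   (EFin \o (fun x : measurableTypeR R => (`|f 0| + `|x|)%R))).
- by apply/measurable_EFinP; exact: slope01_measurable.
- move=> x _ /=; rewrite lee_fin [leRHS]ger0_norm ?addr_ge0//.
  exact: slope01_norm.
- rewrite (_ : _ \o _ = (EFin \o cst `|f 0|%R) \+
      (abse \o (fun x : measurableTypeR R => x%:E)))%E//.
  apply: integrableD => //; first exact: integrable_cst.
  exact: integrable_abse.
Qed.

Lemma slope01_mean (h : R -> R -> R) :
  (forall y, slope01 (h y)) -> (forall x, slope01 (h ^~ x)) ->
  slope01 (fun y => mean P (h y)).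
Proof.
move=> sx sy a b ab.
rewrite -meanB; [|exact/integrable_slope01..].
rewrite -[X in X <= _ <= _](mean_cst P) -[X in _ <= _ <= X](mean_cst P).
have ih : P.-integrable setT (EFin \o (h b \- h a : measurableTypeR R -> R)).
  rewrite (_ : _ \o _ = (EFin \o (h b : measurableTypeR R -> R)) \-
      (EFin \o (h a : measurableTypeR R -> R)))%E//.
  by apply: integrableB => //; exact/integrable_slope01.
by apply/andP; split; apply: le_mean => //; (try exact: integrable_cst);
  move=> x; have /andP[] := sy x _ _ ab.
Qed.

End MeanReal.

(** * Exchange of two independent capped draws *)

Section Swap.
Context {R : realType} (P Q : probability (measurableTypeR R) R).
Hypothesis Pmean : P.-integrable setT (fun x : measurableTypeR R => x%:E).
Hypothesis Qmean : Q.-integrable setT (fun x : measurableTypeR R => x%:E).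

(** Fubini applies because the integrand grows at most linearly in [x] and [y], which are integrable
    for the product law. *)
Lemma slope01_swap (f : R -> R) a b : slope01 f ->
  mean P (fun x => mean Q (fun y => f (Num.max (Num.min x a) (Num.min y b)))) =
  mean Q (fun y => mean P (fun x => f (Num.max (Num.min x a) (Num.min y b)))).
Proof.
move=> sf.
pose G (p : measurableTypeR R * measurableTypeR R) : \bar R :=
  (f (Num.max (Num.min p.1 a) (Num.min p.2 b)))%:E.
have G1 x : slope01 (fun y => f (Num.max (Num.min x a) (Num.min y b))).
  exact: (slope01_comp sf (slope01_comp (slope01_max _) (slope01_min _))).
have G2 y : slope01 (fun x => f (Num.max (Num.min x a) (Num.min y b))).
  under eq_fun do rewrite maxC.
  exact: (slope01_comp sf (slope01_comp (slope01_max _) (slope01_min _))).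
have mG : measurable_fun setT G.
  apply/measurable_EFinP/(measurableT_comp (slope01_measurable sf)).
  by apply: measurable_maxr; apply: measurable_minr.
pose X1 (p : measurableTypeR R * measurableTypeR R) : \bar R := (p.1)%:E.
pose X2 (p : measurableTypeR R * measurableTypeR R) : \bar R := (p.2)%:E.
have i1 : (P \x Q)%E.-integrable setT X1.
  apply/integrable12ltyP; first by apply/measurable_EFinP; exact: measurable_fst.
  rewrite /X1/=.
  under eq_integral do rewrite integral_cst//= probability_setT mule1.
  by case/integrableP : Pmean.
have i2 : (P \x Q)%E.-integrable setT X2.
  apply/integrable21ltyP; first by apply/measurable_EFinP; exact: measurable_snd.
  rewrite /X2/=.
  under eq_integral do rewrite integral_cst//= probability_setT mule1.
  by case/integrableP : Qmean.
have iG : (P \x Q)%E.-integrable setT G.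
  apply: (@le_integrable _ _ _ _ setT measurableT _
     ((cst (`|f 0| + `|a| + `|b|)%:E \+ (abse \o X1)) \+ (abse \o X2))%E) => //.
    move=> -[x y] _; rewrite /G/= lee_fin [leRHS]ger0_norm ?addr_ge0//.
    apply: (le_trans (slope01_norm _ sf)); rewrite -!addrA lerD2l.
    have := normr_ge0 x; have := normr_ge0 y; have := normr_ge0 a.
    have := normr_ge0 b.
    case: (leP x a) => _; case: (leP y b) => _.
    - by case: (leP x y) => _; lra.
    - by case: (leP x b) => _; lra.
    - by case: (leP a y) => _; lra.
    - by case: (leP a b) => _; lra.
  apply: integrableD => //; last exact: integrable_abse.
  apply: integrableD => //; last exact: integrable_abse.
  apply/integrable12ltyP => //=.
  under eq_integral do rewrite integral_cst//= probability_setT mule1.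
  by rewrite integral_cst//= probability_setT mule1 ltry.
have := congr1 fine (Fubini iG).
under eq_integral do rewrite /G/= (meanE (integrable_slope01 Qmean (G1 _))).
under [in X in _ = X -> _]eq_integral do
  rewrite /G/= (meanE (integrable_slope01 Pmean (G2 _))).
by [].
Qed.
End Swap.

Lemma rem_comm (T : eqType) (j k : T) (s : seq T) :
  rem j (rem k s) = rem k (rem j s).
Proof.
elim: s => //= i s IH.
have [ik|ik] := eqVneq i k; have [ij|ij] := eqVneq i j => /=.
- by rewrite -ij -ik.
- by rewrite ik eqxx.
- by rewrite ij eqxx.
- by rewrite (negbTE ik) (negbTE ij) IH.
Qed.

(** * Weitzman's value of a state and its one-step comparisons *)

Section IndexValue.
Context {R : realType} {T : eqType} (F : T -> probability (measurableTypeR R) R).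
Hypothesis Fmean :
  forall k, (F k).-integrable setT (fun x : measurableTypeR R => x%:E).
Variables z c : T -> R.
Hypothesis c_gt0 : forall k, 0 < c k.
(** The reservation value equation [E (x - z k)^+ = c k] with [z k] added to both sides. *)
Hypothesis meanmax :
  forall k, mean (F k) (fun x => Num.max x (z k) : R) = z k + c k.
Implicit Types (L : seq T) (m : option R) (f : R -> R).

(* [None] is the state in which nothing has been inspected yet. *)
Definition omax m (x : R) : R := if m is Some y then Num.max y x else x.

(* E max(y, max_(k in L) min(x_k, z k)), the [x_k] being drawn independently. *)
Fixpoint index_value L (y : R) : R :=
  if L is k :: L' then
    mean (F k) (fun x => index_value L' (Num.max y (Num.min x (z k))))
  else y.

(** Inspection of [k] with the draw capped at [z k] and the cost waived. For [m = Some y] it is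
    [index_value (k :: L) y]; for [m = None] it plays the role of the state value at the outset,
    where no fallback value exists. *)
Definition index_payoff m k L : R :=
  mean (F k) (fun x => index_value L (omax m (Num.min x (z k)))).

Definition inspect_payoff m k L : R :=
  mean (F k) (fun x => index_value L (omax m x)) - c k.

Lemma slope01_omax m : slope01 (omax m).
Proof. by case: m => [y|]; [exact: slope01_max|exact: slope01_id]. Qed.

Lemma slope01_index_value L : slope01 (index_value L).
Proof.
elim: L => [|k L IH]; first exact: slope01_id.
apply: (slope01_mean (Fmean k)) => a.
- exact: (slope01_comp IH (slope01_comp (slope01_max _) (slope01_min _))).
- apply: (slope01_comp IH); under eq_fun do rewrite maxC.
  exact: slope01_max.
Qed.

Let integrable_slope k f : slope01 f ->
  (F k).-integrable setT (EFin \o (f : measurableTypeR R -> R)).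
Proof. exact: integrable_slope01. Qed.

(** The recursion integrates the draws in list order; by Fubini the order is immaterial, so any
    product can be taken as the first. *)
Lemma index_value_swap j k L y :
  index_value [:: j, k & L] y = index_value [:: k, j & L] y.
Proof.
have sf : slope01 (index_value L \o Num.max y).
  exact: slope01_comp (slope01_index_value L) (slope01_max y).
have := slope01_swap (Fmean j) (Fmean k) (z j) (z k) sf.
rewrite /=; under eq_fun do under eq_fun do rewrite maxA.
move=> ->; under eq_fun do under eq_fun do rewrite maxA.
congr mean; apply/funext => x; congr mean; apply/funext => x'.
by rewrite -maxA maxAC maxA.
Qed.

Lemma index_value_rem k L y : k \in L ->
  index_value L y = index_value (k :: rem k L) y.
Proof.
elim: L y => //= j L IH y; rewrite inE eq_sym.
have [-> //|_ /= kL] := eqVneq j k.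
rewrite -[RHS](index_value_swap j k).
by congr mean; apply/funext => x; rewrite IH.
Qed.

Lemma index_payoff_Some y k L : k \in L ->
  index_payoff (Some y) k (rem k L) = index_value L y.
Proof. by move=> kL; rewrite (index_value_rem _ kL). Qed.

(** For [m = None], the other product is brought to the head of the remaining list, and the two
    outermost draws are exchanged. *)
Lemma index_payoff_rem m j k L : j \in L -> k \in L ->
  index_payoff m j (rem j L) = index_payoff m k (rem k L).
Proof.
case: m => [y|] jL kL; first by rewrite !index_payoff_Some.
have [-> //|jk] := eqVneq j k.
have jL' : j \in rem k L.
  move: jL; rewrite (perm_mem (perm_to_rem kL)) inE => /predU1P[] // ejk.
  by rewrite ejk eqxx in jk.
have kL' : k \in rem j L.
  move: kL; rewrite (perm_mem (perm_to_rem jL)) inE => /predU1P[] // ejk.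
  by rewrite ejk eqxx in jk.
rewrite /index_payoff /=.
under eq_fun do rewrite (index_value_rem _ kL') /=.
under [in RHS]eq_fun do rewrite (index_value_rem _ jL') /=.
rewrite (slope01_swap (Fmean j) (Fmean k) _ _ (slope01_index_value _)).
congr mean; apply/funext => x; congr mean; apply/funext => x'.
by rewrite maxC rem_comm.
Qed.

Lemma index_value_le L y : {in L, forall j, z j <= y} -> index_value L y = y.
Proof.
elim: L => //= k L IH Lz.
rewrite -[RHS](mean_cst (F k)); congr mean; apply/funext => x /=.
rewrite max_l; first by rewrite IH// => j jL; apply: Lz; rewrite inE jL orbT.
by rewrite ge_min Lz ?mem_head ?orbT.
Qed.

Lemma index_value_ge L y : y <= index_value L y.
Proof.
elim: L y => //= k L IH y; rewrite -[leLHS](mean_cst (F k)).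
apply: le_mean => [||x]; first exact: integrable_cst.
- apply: integrable_slope; apply: (slope01_comp (slope01_index_value L)).
  exact: (slope01_comp (slope01_max _) (slope01_min _)).
- by apply: le_trans (IH _); rewrite le_max lexx.
Qed.

(** Draws above [z k] cannot be negligible, as their excess over [z k] has mean [c k > 0]; this
    excess is the witness for [lt_mean]. *)
Lemma lt_mean_above k (f g : measurableTypeR R -> R) :
  (F k).-integrable setT (EFin \o f) -> (F k).-integrable setT (EFin \o g) ->
  (forall x, f x <= g x) -> (forall x, z k < x -> f x < g x) ->
  mean (F k) f < mean (F k) g.
Proof.
move=> fi gi fg fgz.
pose h : measurableTypeR R -> R := (fun x : R => Num.max x (z k)) \- cst (z k).
have i1 : (F k).-integrable setT
    (EFin \o (fun x : measurableTypeR R => Num.max (x : R) (z k))).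
  apply: (@integrable_slope k); under eq_fun do rewrite maxC.
  exact: slope01_max.
apply: (lt_mean fi gi (g := h)) => //.
- rewrite (_ : _ \o _ =
      (EFin \o (fun x : measurableTypeR R => Num.max (x : R) (z k))) \-
      (EFin \o cst (z k)))%E//.
  by apply: integrableB => //; exact: integrable_cst.
- move=> x; rewrite /h /=; case: (leP x (z k)); first by rewrite subrr.
  by move/fgz => + fgx; rewrite fgx ltxx.
- rewrite /h meanB//; last exact: integrable_cst.
  by rewrite mean_cst meanmax addrAC subrr add0r gt_eqF.
Qed.

Lemma slope01_addr f a : slope01 f -> slope01 (fun x => f x + a).
Proof. by move=> sf x y xy; have := sf _ _ xy; lra. Qed.

Lemma mean_slope_addr k f a : slope01 f ->
  mean (F k) (fun x => f x + a) = mean (F k) f + a.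
Proof.
move=> sf; rewrite -[a in RHS](mean_cst (F k)).
by rewrite -meanD//; [exact: integrable_slope|exact: integrable_cst].
Qed.

(** A better fallback is worth its full improvement only if it is not superseded. When [j] draws
    above [z j], the capped draw [z j] beats [a], and the gain is at most
    [max b (z j) - z j < b - a]. *)
Lemma index_value_lt L j a b : j \in L -> a < b -> a < z j ->
  index_value L b < index_value L a + (b - a).
Proof.
move=> jL ab azj; rewrite !(index_value_rem _ jL) /=.
set L' := rem j L; have sL' := slope01_index_value L'.
have sm y : slope01 (fun x => index_value L' (Num.max y (Num.min x (z j)))).
  exact: (slope01_comp sL' (slope01_comp (slope01_max _) (slope01_min _))).
rewrite -mean_slope_addr//; apply: lt_mean_above => [||x|x zx].
- exact: integrable_slope.
- by apply: integrable_slope; apply: slope01_addr.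
- set w := Num.min x (z j).
  have mab : Num.max a w <= Num.max b w by rewrite ge_max !le_max ltW//= lexx orbT.
  have /andP[_] := sL' _ _ mab.
  by case: (leP a w); case: (leP b w); lra.
- rewrite (min_r (ltW zx)) (max_r (ltW azj)).
  have mab : z j <= Num.max b (z j) by rewrite le_max lexx orbT.
  have /andP[_] := sL' _ _ mab.
  by case: (leP b (z j)); lra.
Qed.

(** Take [b = z j] in [index_value_lt] and use that the value at [z j] is at least [z j]. *)
Lemma index_value_gt L j y : j \in L -> y < z j -> y < index_value L y.
Proof.
move=> jL yz; have := index_value_ge L (z j).
by have := index_value_lt jL yz yz; lra.
Qed.

(** Moves the cost inside the expectation as the excess [(x - z k)^+], so that the true and the
    capped payoff can be compared pointwise in [x]. *)
Lemma mean_excess k f : slope01 f ->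
  mean (F k) (fun x => f (Num.min x (z k)) + (Num.max x (z k) - z k)) =
  mean (F k) (fun x => f (Num.min x (z k))) + c k /\
  (F k).-integrable setT (EFin \o (fun x : measurableTypeR R =>
     f (Num.min (x : R) (z k)) + (Num.max (x : R) (z k) - z k))).
Proof.
move=> sf.
have s1 := slope01_comp sf (slope01_min (z k)).
have s2 : slope01 (fun x => Num.max x (z k) - z k).
  by apply: slope01_addr; under eq_fun do rewrite maxC; exact: slope01_max.
have i1 := @integrable_slope k _ s1; have i2 := @integrable_slope k _ s2.
split; last exact: (integrableD measurableT i1 i2).
rewrite [LHS](meanD i1 i2); congr (_ + _).
rewrite mean_slope_addr ?meanmax; first by rewrite addrAC subrr add0r.
by under eq_fun do rewrite maxC; exact: slope01_max.
Qed.

(* The idea is [f x <= f (min x z_k) + (x - z_k)^+], as [f] has slope at most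
   one, and that the mean of the last term is the search cost. *)
Lemma inspect_payoff_le m k L : inspect_payoff m k L <= index_payoff m k L.
Proof.
have sf := slope01_comp (slope01_index_value L) (slope01_omax m).
have [e1 i1] := mean_excess k sf.
rewrite /inspect_payoff lerBlDr -[leRHS]e1.
apply: le_mean => // [|x]; first exact: integrable_slope.
case: (leP x (z k)) => [xz|/ltW/sf/andP[_]]; first by rewrite subrr addr0.
by rewrite /=; lra.
Qed.

(** For [x > z k], uncapping the draw gains strictly less than [x - z k]: part of the gain is lost
    to a fallback above [z k], or to a product of higher index by [index_value_lt]. *)
Lemma inspect_payoff_lt m k L :
  (exists2 y, m = Some y & z k < y) \/ (exists2 j, j \in L & z k < z j) ->
  inspect_payoff m k L < index_payoff m k L.
Proof.
move=> subopt.
have sf := slope01_comp (slope01_index_value L) (slope01_omax m).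
have [e1 i1] := mean_excess k sf.
rewrite /inspect_payoff ltrBlDr -[ltRHS]e1.
apply: lt_mean_above => // [|x|x zx]; first exact: integrable_slope.
  case: (leP x (z k)) => [xz|/ltW/sf/andP[_]]; first by rewrite subrr addr0.
  by rewrite /=; lra.
rewrite (min_r (ltW zx)) (max_l (ltW zx)) /=.
have stop y : z k < y ->
    index_value L (Num.max y x) < index_value L (Num.max y (z k)) + (x - z k).
  move=> zy; rewrite (max_l (ltW zy)).
  have yx : y <= Num.max y x by rewrite le_max lexx.
  have /andP[_] := slope01_index_value L yx.
  by case: (leP y x); lra.
case: subopt => [[y my zy]|[j jL zkj]]; first by rewrite my; apply: stop.
case: m {sf e1 i1} => [y|] /=; last exact: (index_value_lt jL).
have [yz|] := boolP (y <= z k); last by rewrite -ltNge; exact: stop.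
rewrite (max_r (ltW (le_lt_trans yz zx))) ?max_r//.
exact: (index_value_lt jL).
Qed.

(** When [k] has the top value, a draw above [z k] ends the search: the continuation value is the
    draw itself, of slope exactly one, and nothing is lost pointwise. *)
Lemma inspect_payoff_top m k L : {in L, forall j, z j <= z k} ->
  (forall y, m = Some y -> y <= z k) -> inspect_payoff m k L = index_payoff m k L.
Proof.
move=> Lz mz.
have sf := slope01_comp (slope01_index_value L) (slope01_omax m).
have [e1 i1] := mean_excess k sf.
apply/eqP; rewrite /inspect_payoff subr_eq -e1; apply/eqP.
congr mean; apply/funext => x.
case: (leP x (z k)) => [xz|zx]; first by rewrite subrr addr0.
have om w : z k <= w -> omax m w = w.
  by case: m mz {sf e1 i1} => //= y /(_ _ erefl) yz zw; rewrite max_r// (le_trans yz).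
rewrite /= !om ?(ltW zx)// !index_value_le//; first by lra.
by move=> j /Lz zj; rewrite (le_trans zj)// ltW.
Qed.

End IndexValue.

(** * Histories summarized by the best value and the uninspected products *)

Section Histories.
Context {R : realType} {T : finType}.
Implicit Types (h : history R T) (L : seq T).

Definition best h : option R := foldl (fun m p => Some (omax m p.2)) None h.

Lemma best_rcons h p : best (rcons h p) = Some (omax (best h) p.2).
Proof. by rewrite /best foldl_rcons. Qed.

Lemma best_ge h p : p \in h -> exists2 y, best h = Some y & p.2 <= y.
Proof.
elim/last_ind: h => // h q IH; rewrite mem_rcons inE best_rcons.
case/predU1P => [->|/IH[y -> py]].
- exists (omax (best h) q.2) => //.
  by case: (best h) => [y|] /=; rewrite ?le_max lexx ?orbT.
- by exists (Num.max y q.2) => //; rewrite le_max py.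
Qed.

Lemma best_mem h y : best h = Some y -> exists2 p, p \in h & p.2 = y.
Proof.
elim/last_ind: h y => // h q IH y; rewrite best_rcons => -[].
case: (best h) IH => [w|] IH /= <-; last by exists q; rewrite // mem_rcons mem_head.
case: (leP w q.2) => _; first by exists q; rewrite // mem_rcons mem_head.
by have [p ph pw] := IH _ erefl; exists p; rewrite // mem_rcons inE ph orbT.
Qed.

Definition uninspected h L : Prop :=
  [/\ uniq L, uniq (inspected h) & forall k, (k \in L) = (k \notin inspected h)].

Lemma inspected_rcons h p : inspected (rcons h p) = rcons (inspected h) p.1.
Proof. exact: map_rcons. Qed.

Lemma uninspected_rcons h L k x : uninspected h L -> k \in L ->
  uninspected (rcons h (k, x)) (rem k L).
Proof.
move=> [uL uh Lh] kL; split; first exact: rem_uniq.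
- by rewrite inspected_rcons rcons_uniq uh -Lh kL.
- move=> j; rewrite inspected_rcons mem_rcons inE negb_or mem_rem_uniq//.
  by rewrite !inE Lh.
Qed.

(** Identifies the horizon of [dp_value] with [(size L).+1]. *)
Lemma uninspected_size h L : uninspected h L -> (size L + size h)%N = #|T|.
Proof.
move=> [uL uh Lh]; rewrite -(size_map fst h) -size_cat cardT.
apply/perm_size/uniq_perm; first last.
- by move=> k; rewrite mem_cat Lh orNb mem_enum.
- exact: enum_uniq.
- rewrite cat_uniq uL uh andbT /=; apply/hasPn => k kh.
  by rewrite Lh negbK.
Qed.

End Histories.

(** * Solution of the dynamic program *)

Section DynamicProgram.
Context {R : realType} {T : finType} (e : environment R T) (z : T -> R).
Hypotheses (He : weitzman_style e) (Hindep : independence e)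
  (Hinv : invariance e) (Hz : forall k, reservation_value e k (z k)).
Implicit Types (h : history R T) (L : seq T).

Let F := belief e [::].
Let c := cost e [::].

Let Fmean k : (F k).-integrable setT (fun x : measurableTypeR R => x%:E).
Proof. exact: belief_mean He _ _. Qed.

Let c_gt0 k : 0 < c k.
Proof. exact: cost_gt0 He _ _. Qed.

Lemma mean_max_reservation k :
  mean (F k) (fun x => Num.max x (z k) : R) = z k + c k.
Proof.
have s1 : slope01 (fun x : R => Num.max x (z k)).
  by under eq_fun do rewrite maxC; exact: slope01_max.
have s2 : slope01 (fun x : R => Num.max x (z k) - z k) by exact: slope01_addr.
have := Hz k; rewrite /reservation_value integral_mkcond.
under eq_integral => x _.
  rewrite (_ : _ x = (Num.max (x : R) (z k) - z k)%:E); last first.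
    rewrite patchE mem_setE in_itv/= andbT.
    by case: (leP (z k) x) => //; rewrite subrr.
  over.
rewrite (meanE (integrable_slope01 (Fmean k) s2)) => -[].
by rewrite mean_slope_addr// /c => ->; rewrite addrC subrK.
Qed.

(** Independence and Invariance enter here, by induction on the history: uninspected products keep
    their initial cost and law, and inspected ones stay purchasable at the revealed value. *)
Lemma environment_history h : uniq (inspected h) ->
  [/\ forall k, feasible e h (Inspect k) = (k \notin inspected h),
      forall k, feasible e h (Purchase k) = (k \in inspected h),
      forall k, k \notin inspected h -> cost e h k = c k,
      forall p, p \in h -> utility e h p.1 = p.2 &
      forall k A, k \notin inspected h -> measurable A ->
        belief e h k A = F k A].
Proof.
elim/last_ind: h => [_|h [j x] IH].
  split=> // k; first exact: inspect_at_outset He k.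
  by apply/negP => /(purchase_after_inspect He).
rewrite inspected_rcons rcons_uniq /= => /andP[jh uh].
have [fI fP ch ut be] := IH uh.
have fj : feasible e h (Inspect j) by rewrite fI.
have [inv1 inv2 inv3] := Hinv x fj.
split=> [k|k|k|p|k A].
- apply/idP/idP => [|].
    apply: contraTN => kh; apply: (inspect_once He).
    by rewrite inspected_rcons.
  rewrite mem_rcons inE negb_or => /andP[kj kh]; apply: inv1; first by rewrite fI.
  by apply: contra kj => /eqP[->].
- apply/idP/idP => [/(purchase_after_inspect He)|].
    by rewrite inspected_rcons.
  rewrite mem_rcons inE => /predU1P[->|kh]; first exact: (inspect_enables He).
  by apply: inv1; rewrite ?fP.
- rewrite mem_rcons inE negb_or => /andP[kj kh].
  by rewrite inv2 ?fI// ch.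
- rewrite mem_rcons inE => /predU1P[->|ph]; first exact: (inspect_reveals He).
  by rewrite inv3 ?ut// fP; apply/mapP; exists p.
- rewrite mem_rcons inE negb_or => /andP[kj kh] mA.
  by rewrite Hindep ?be.
Qed.

Section Payoff.
Variables (V : history R T -> \bar R) (h : history R T) (L : seq T).
Hypothesis hL : uninspected h L.
(** Leaving [V] abstract lets the one-step lemmas serve both the finite-horizon induction and
    [dp_value]. *)
Hypothesis HV : forall k x, k \in L ->
  V (rcons h (k, x)) = (index_value F z (rem k L) (omax (best h) x))%:E.

Lemma payoff_inspect k : k \in L ->
  action_payoff e V h (Inspect k) =
  (inspect_payoff F z c (best h) k (rem k L))%:E.
Proof.
move=> kL; have [uL uh Lh] := hL.
have [_ _ ch _ be] := environment_history uh.
have kh : k \notin inspected h by rewrite -Lh.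
rewrite /= ch// EFinB; congr (_ + _)%E.
rewrite (eq_measure_integral (F k)); last by move=> A mA _; exact: be.
under eq_integral do rewrite HV//.
rewrite meanE//; apply: integrable_slope01 => //.
exact: (slope01_comp (slope01_index_value Fmean z _) (slope01_omax _)).
Qed.

Lemma payoff_best y : best h = Some y ->
  exists2 k, feasible e h (Purchase k) &
    action_payoff e V h (Purchase k) = y%:E.
Proof.
have [uL uh Lh] := hL.
have [_ fP _ ut _] := environment_history uh.
move=> /best_mem[p ph <-]; exists p.1; last by rewrite /= ut.
by rewrite fP; apply/mapP; exists p.
Qed.

Lemma payoff_purchase_le k : feasible e h (Purchase k) ->
  exists2 y, best h = Some y & (action_payoff e V h (Purchase k) <= y%:E)%E.
Proof.
have [uL uh Lh] := hL.
have [_ fP _ ut _] := environment_history uh.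
rewrite fP => /mapP[p ph ->] /=.
by have [y -> py] := best_ge ph; exists y; rewrite // ut// lee_fin.
Qed.

(** The index policy attains the bound: inspect the product [t] of highest reservation value, unless
    the best value found exceeds [z t], in which case purchase. *)
Lemma payoff_attained k : k \in L ->
  exists2 b, feasible e h b &
    action_payoff e V h b = (index_payoff F z (best h) k (rem k L))%:E.
Proof.
move=> kL; have [uL uh Lh] := hL.
have [fI _ _ _ _] := environment_history uh.
have [t tL zt] : exists2 t, t \in L & {in L, forall j, z j <= z t}.
  case: (@arg_maxP _ _ T k (mem L) z kL) => t tL zt.
  by exists t.
case: (pselect (forall y, best h = Some y -> y <= z t)) => [yz|].
  exists (Inspect t); first by rewrite fI -Lh.
  rewrite payoff_inspect// (inspect_payoff_top Fmean mean_max_reservation)//.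
  - by rewrite (index_payoff_rem Fmean z _ tL kL).
  - by move=> j /mem_rem /zt.
move=> /existsNP[y /not_implyP[bh /negP]]; rewrite -ltNge => zy.
have [j fj pj] := payoff_best bh; exists (Purchase j) => //.
rewrite pj bh index_payoff_Some// index_value_le// => i /zt zi.
exact: le_trans zi (ltW zy).
Qed.

(** The Bellman equation: no action exceeds the index value, and [payoff_attained] reaches it; with
    no product left, the best purchase does. *)
Lemma bigmax_payoff y : best h = Some y ->
  (\big[maxe/-oo]_(a : action T | feasible e h a) action_payoff e V h a =
  (index_value F z L y)%:E)%E.
Proof.
move=> hy; have [uL uh Lh] := hL.
have [fI _ _ _ _] := environment_history uh.
apply/eqP; rewrite eq_le; apply/andP; split.
  apply: bigmax_le => [|[k|k] fk]; first exact: leNye.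
  - have kL : k \in L by rewrite Lh -fI.
    rewrite payoff_inspect// lee_fin -(index_payoff_Some Fmean z y kL) -hy.
    exact: (inspect_payoff_le Fmean mean_max_reservation).
  - have [w] := payoff_purchase_le fk; rewrite hy => -[<-] /le_trans; apply.
    by rewrite lee_fin (index_value_ge Fmean).
have [b fb <-] : exists2 b, feasible e h b &
    action_payoff e V h b = (index_value F z L y)%:E; last exact: le_bigmax_cond.
have [L0|[k kL]] : L = [::] \/ exists k, k \in L.
- by case: (L) => [|k s]; [left|right; exists k; rewrite mem_head].
- by have [k fk pk] := payoff_best hy; exists (Purchase k); rewrite // pk L0.
- have [b fb pb] := payoff_attained kL; exists b => //.
  by rewrite pb hy index_payoff_Some.
Qed.

End Payoff.

Lemma horizon_valueE L h y : uninspected h L -> best h = Some y ->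
  horizon_value e (size L).+1 h = (index_value F z L y)%:E.
Proof.
move eqn : (size L) => n.
elim: n L h y eqn => [|n IH] L h y sL hL hy; apply: bigmax_payoff => // k x kL.
(* With [L] empty no inspection is feasible, so the value [-oo] of horizon 0 never matters. *)
- by move: kL; rewrite (size0nil sL).
- apply: IH; first by rewrite size_rem// sL.
    exact: uninspected_rcons.
  by rewrite best_rcons.
Qed.

Lemma dp_value_rcons L h k x : uninspected h L -> k \in L ->
  dp_value e (rcons h (k, x)) =
  (index_value F z (rem k L) (omax (best h) x))%:E.
Proof.
move=> hL kL; have hL' := uninspected_rcons x hL kL.
rewrite /dp_value -(uninspected_size hL') -addSn addnK.
by apply: horizon_valueE => //; rewrite best_rcons.
Qed.

(** Suppose [b] has the higher value. An inspection [a] then pays strictly less than the attained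
    index value. A purchase [a] must be of the best value found, so [b] inspects some [j] with [z j]
    above it, and continuing is strictly better. *)
Lemma optimal_action_value (u : T -> R) h a b :
  uniq (inspected h) -> (forall p, p \in h -> p.2 = u p.1) ->
  (forall b, feasible e h b ->
    action_payoff e (dp_value e) h b <= action_payoff e (dp_value e) h a)%E ->
  feasible e h a -> feasible e h b -> action_value z u b <= action_value z u a.
Proof.
move=> uh hu opt fa fb.
pose L := [seq k <- enum T | k \notin inspected h].
have hL : uninspected h L.
  split=> // [|k]; first exact/filter_uniq/enum_uniq.
  by rewrite mem_filter mem_enum andbT.
have Lh : forall k, (k \in L) = (k \notin inspected h) by case: hL.
have HV k x := @dp_value_rcons L h k x hL.
have [fI fP _ ut _] := environment_history uh.
have utk k : k \in inspected h -> utility e h k = u k.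
  by move=> /mapP[p ph ->]; rewrite ut// hu.
have best_u k : k \in inspected h -> exists2 y, best h = Some y & u k <= y.
  move=> /mapP[p ph ->]; rewrite -hu//; exact: best_ge.
rewrite leNgt; apply/negP => ab.
case: a fa opt ab => k fk opt /=.
- have kL : k \in L by rewrite Lh -fI.
  have [d fd pd] := payoff_attained hL HV kL.
  move=> ab; have := opt _ fd; rewrite pd (payoff_inspect hL HV)// lee_fin.
  rewrite leNgt => /negP; apply.
  apply: (inspect_payoff_lt Fmean c_gt0 mean_max_reservation).
  case: b fb ab => j fj /= kj; [right; exists j => //|left].
    have [uL _ _] := hL; rewrite mem_rem_uniq// !inE Lh -fI fj andbT.
    by apply: contraTN kj => /eqP ->; rewrite ltxx.
  rewrite fP in fj; have [y hy uy] := best_u _ fj.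
  by exists y => //; exact: lt_le_trans kj uy.
- have kh : k \in inspected h by rewrite -fP.
  have [y hy uy] := best_u _ kh.
  have yu : y <= u k.
    have [i fi pi] := payoff_best (dp_value e) hL hy.
    by have := opt _ fi; rewrite pi /= utk// lee_fin.
  case: b fb => j fj /=; last first.
    rewrite fP in fj; have [w] := best_u _ fj.
    by rewrite hy leNgt => -[<-] /negP uy' kj; apply: uy'; exact: le_lt_trans kj.
  move=> kj; have jL : j \in L by rewrite Lh -fI.
  have [d fd pd] := payoff_attained hL HV jL.
  have := opt _ fd; rewrite pd hy index_payoff_Some// /= utk// lee_fin.
  rewrite leNgt => /negP; apply.
  have yj : y < z j by exact: le_lt_trans yu kj.
  exact: le_lt_trans uy (index_value_gt Fmean c_gt0 mean_max_reservation jL yj).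
Qed.

End DynamicProgram.

(** * Order of positions in sequences *)

Lemma index_pmap (A B : eqType) (f : A -> option B) (g : B -> A) (s : seq A) x y :
  ocancel f g -> uniq s -> x \in pmap f s -> y \in pmap f s ->
  (index x (pmap f s) < index y (pmap f s))%N -> (index (g x) s < index (g y) s)%N.
Proof.
move=> fK; have memg w t : w \in pmap f t -> g w \in t.
  by rewrite mem_pmap => /mapP[a aC fa]; have := fK a; rewrite -fa /= => ->.
elim: s => //= a s IH /andP[aNs us].
have := fK a; case fa : (f a) => [w|] /= gw.
  rewrite !inE; have [->|xw] := eqVneq x w.
    rewrite gw !eqxx; case: (eqVneq y w) => [->|yw] //= _ /memg gy _.
    by case: eqP => // e; rewrite e gy in aNs.
  have [->//|yw] := eqVneq y w => /= xs ys; rewrite ltnS => lt.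
  case: eqP => [e|_]; first by rewrite e (memg _ _ xs) in aNs.
  case: eqP => [e|_]; first by rewrite e (memg _ _ ys) in aNs.
  by rewrite ltnS IH.
move=> xs ys lt.
case: eqP => [e|_]; first by rewrite e (memg _ _ xs) in aNs.
case: eqP => [e|_]; first by rewrite e (memg _ _ ys) in aNs.
by rewrite ltnS IH.
Qed.

Lemma onth_index (A : eqType) (s : seq A) j x :
  uniq s -> onth s j = Some x -> x \in s /\ index x s = j.
Proof.
move=> us sj; have js : (j < size s)%N by rewrite -onthTE sj.
rewrite -(onth_nth x x s j sj) mem_nth//; split=> //.
by rewrite index_uniq.
Qed.

Lemma precedes_trans (T : finType) (s : seq (action T)) a b c :
  precedes s a b -> precedes s b c -> precedes s a c.
Proof. exact: ltn_trans. Qed.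

Lemma precedes_total (T : finType) (s : seq (action T)) a b :
  a \in s -> a != b -> ~~ precedes s a b -> precedes s b a.
Proof.
rewrite /precedes -leqNgt leq_eqVlt => sa ab /predU1P[e|//].
have sb : b \in s by rewrite -index_mem e index_mem.
by case/eqP: ab; rewrite -(nth_index a sa) -e nth_index.
Qed.

(** * What an optimal process reveals at each of its steps *)

Section Process.
Context {R : realType} {T : finType} (e : environment R T).
Variables (z u : T -> R) (s : seq (action T)).
Hypotheses (He : weitzman_style e) (Hindep : independence e)
  (Hinv : invariance e) (Hz : forall k, reservation_value e k (z k))
  (Hties : injective (action_value z u)) (Hs : search_process e u s).

Lemma mem_inspected_history_of s1 k :
  (k \in inspected (history_of u s1)) = (Inspect k \in s1).
Proof.
elim: s1 => //= -[j|j] s1 IH; rewrite inE /=.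
- by rewrite inE IH.
- exact: IH.
Qed.

Lemma history_of_utility s1 p : p \in history_of u s1 -> p.2 = u p.1.
Proof.
by elim: s1 => //= -[j|j] s1 IH //=; rewrite inE => /predU1P[->|].
Qed.

Lemma uniq_history_of s1 s2 :
  s = s1 ++ s2 -> uniq (inspected (history_of u s1)).
Proof.
elim/last_ind: s1 s2 => // s1 a IH s2; rewrite cat_rcons => es.
have uh := IH _ es; have [fI _ _ _ _] := environment_history He Hindep Hinv uh.
have [/(_ _ _ _ es) + _] := Hs; case: a es => k es fk.
- rewrite /history_of -cats1 pmap_cat /= cats1 inspected_rcons rcons_uniq uh.
  by rewrite -fI fk.
- by rewrite /history_of -cats1 pmap_cat cats0.
Qed.

Lemma uniq_process : uniq s.
Proof.
have [_ [s' [k [es ins]]]] := Hs.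
rewrite es rcons_uniq; apply/andP; split.
  by apply/negP => /(allP ins).
have := @uniq_history_of s' [:: Purchase k]; rewrite cats1 => /(_ es).
move=> uh; have -> : s' = [seq Inspect j | j <- inspected (history_of u s')].
  by elim: s' ins {es uh} => //= -[j|j] s' IH //= /IH {1}->.
by rewrite map_inj_uniq// => i j [].
Qed.

Lemma purchase_last k a : Purchase k \in s -> a \in s -> a != Purchase k ->
  precedes s a (Purchase k).
Proof.
have [_ [s' [k0 [es ins]]]] := Hs.
have s'P j : (Purchase j \in s') = false by apply/negP => /(allP ins).
rewrite es !mem_rcons !inE s'P orbF => /eqP[->].
move=> /predU1P[->|as' _]; first by rewrite eqxx.
by rewrite /precedes -cats1 !index_cat as' s'P /= eqxx addn0 index_mem.
Qed.

Lemma inspect_precedes_purchase k : Purchase k \in s ->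
  precedes s (Inspect k) (Purchase k).
Proof.
move=> kP; rewrite purchase_last//.
have es := esym (cat_take_drop (index (Purchase k) s) s).
have uh := uniq_history_of es.
have [_ fP _ _ _] := environment_history He Hindep Hinv uh.
have [/(_ (take (index (Purchase k) s) s) (Purchase k)) + _] := Hs.
move=> /(_ (drop (index (Purchase k) s).+1 s)).
rewrite fP mem_inspected_history_of => Ik; apply: (mem_take (Ik _)).
by rewrite -[X in X :: _](nth_index (Purchase k) kP) -drop_nth ?index_mem ?cat_take_drop.
Qed.

Hypothesis Hopt : optimal_process e u s.

Let step a b : a \in s ->
  feasible e (history_of u (take (index a s) s)) b ->
  action_value z u b <= action_value z u a.
Proof.
move=> sa.
have es : s = take (index a s) s ++ a :: drop (index a s).+1 s.
  by rewrite -[X in X :: _](nth_index a sa) -drop_nth ?index_mem ?cat_take_drop.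
apply: (optimal_action_value He Hindep Hinv Hz (uniq_history_of es)).
- exact: history_of_utility.
- exact: Hopt es.
- by have [/(_ _ _ _ es)] := Hs.
Qed.

(** The negated [precedes] covers products inspected later as well as never: either way [Inspect k]
    is feasible when [a] is selected. *)
Lemma step_inspect a k : a \in s -> a != Inspect k ->
  ~~ precedes s (Inspect k) a -> z k < action_value z u a.
Proof.
move=> sa ak nprec; rewrite lt_neqAle; apply/andP; split.
  by apply: contra ak => /eqP ka; rewrite -(inj_eq Hties) -ka.
apply: (@step a (Inspect k) sa).
have uh := uniq_history_of (esym (cat_take_drop (index a s) s)).
have [-> _ _ _ _] := environment_history He Hindep Hinv uh.
by rewrite mem_inspected_history_of; apply: contra nprec => /index_ltn.
Qed.

Lemma step_purchase a k : a \in s -> a != Purchase k ->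
  precedes s (Inspect k) a -> u k < action_value z u a.
Proof.
move=> sa ak prec; rewrite lt_neqAle; apply/andP; split.
  by apply: contra ak => /eqP ka; rewrite -(inj_eq Hties) -ka.
apply: (@step a (Purchase k) sa).
have uh := uniq_history_of (esym (cat_take_drop (index a s) s)).
have [_ -> _ _ _] := environment_history He Hindep Hinv uh.
rewrite mem_inspected_history_of in_take//.
by rewrite -index_mem (ltn_trans prec)// index_mem.
Qed.

(** At the step of [a], either the child or the parent is available and declined, which bounds one
    of the two terms of the minimum. *)
Lemma step_composite a k : a \in s -> a != Inspect k -> a != Purchase k ->
  Num.min (z k) (u k) < action_value z u a.
Proof.
move=> sa aI aP; have [prec|nprec] := boolP (precedes s (Inspect k) a).
- by rewrite gt_min orbC step_purchase.
- by rewrite gt_min step_inspect.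
Qed.

End Process.

(** * The recast sequence and its relation to the complete one *)

Section Recast.
Context {T : finType}.
Implicit Types (M : pred T) (obs : pred (action T)) (s : seq (action T)).

(** A composite action is located in the complete sequence at its purchase, the only part whose
    selection counts. *)
Definition selection (a : raction T) : action T :=
  match a with Single b => b | Composite k => Purchase k end.

Lemma selectionK M : ocancel (recast_action M) selection.
Proof. by move=> [k|k] /=; case: (M k). Qed.

Lemma mem_recast M obs s a :
  (a \in recast M obs s) =
  [&& obs (selection a), selection a \in s &
      recast_action M (selection a) == Some a].
Proof.
rewrite /recast mem_pmap; apply/mapP/and3P => [[b]|[oa sa /eqP ea]].
- rewrite mem_filter => /andP[ob sb] eb.
  by have := selectionK M b; rewrite -eb /= => ->; rewrite eb.
- by exists (selection a); rewrite ?mem_filter ?oa.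
Qed.

Lemma recast_inspect M obs s k : (Single (Inspect k) \in recast M obs s) =
  [&& obs (Inspect k), Inspect k \in s & ~~ M k].
Proof. by rewrite mem_recast /=; case: (M k) => //=; rewrite eqxx. Qed.

Lemma recast_purchase M obs s k : (Single (Purchase k) \in recast M obs s) =
  [&& obs (Purchase k), Purchase k \in s & ~~ M k].
Proof. by rewrite mem_recast /=; case: (M k) => //=; rewrite eqxx. Qed.

Lemma recast_composite M obs s k : (Composite k \in recast M obs s) =
  [&& obs (Purchase k), Purchase k \in s & M k].
Proof. by rewrite mem_recast /=; case: (M k) => //=; rewrite eqxx. Qed.

Lemma uniq_recast M obs s : uniq s -> uniq (recast M obs s).
Proof. by move=> us; rewrite (pmap_uniq (selectionK M))// filter_uniq. Qed.

Lemma recast_precedes M obs s a b : uniq s ->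
  a \in recast M obs s -> b \in recast M obs s ->
  (index a (recast M obs s) < index b (recast M obs s))%N ->
  precedes s (selection a) (selection b).
Proof.
have -> : recast M obs s =
    pmap (fun a => if obs a then recast_action M a else None) s.
  rewrite /recast; elim: s => //= c s IH.
  by case: (obs c) => //=; rewrite IH.
move=> us; apply: index_pmap us => c /=.
by case: (obs c) => //; exact: selectionK.
Qed.

(** An action feasible at step [j] is not among the first [j] selections; if it is selected at all
    and is not [a], this happens later. *)
Lemma accessible_index M r j a b : uniq r -> onth r j = Some a -> b \in r ->
  b != a -> rfeasible M r j b -> forward_accessible M r j.
Proof.
move=> ur ja br ba fb; exists b => //.
have btj : b \notin take j r.
  by case: b fb {br ba} => [[k|k]|k] /=; [case/andP|case/and3P|case/andP].
have jb : (j < index b r)%N.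
  rewrite ltn_neqAle leqNgt -in_take// btj andbT.
  apply: contra ba => /eqP jb; move: ja.
  by rewrite jb => /(onth_nth b)<-; rewrite nth_index.
exists (index b r - j)%N; first by rewrite subn_gt0.
rewrite subnKC ?(ltnW jb)//; apply/eqP.
have : (index b r < size r)%N by rewrite index_mem.
by rewrite -onthTE; case E : onth => [c|]// _; rewrite -(onth_nth b c r _ E) nth_index.
Qed.

Lemma unmerged_determined (Omega : set (seq (action T))) obs k a :
  ~~ merged Omega obs k -> obs a -> determined Omega obs k a.
Proof. by move=> /asboolPn nM oa; apply: contrapT => nd; apply: nM; exists a. Qed.

End Recast.

Theorem theorem2 (R : realType) (T : finType) (e : environment R T)
    (z u : T -> R) (s : seq (action T))
    (Omega : set (seq (action T))) (obs : pred (action T))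
    (He : weitzman_style e) (Hindep : independence e) (Hinv : invariance e)
    (Hz : forall k : T, reservation_value e k (z k))
    (Hties : injective (action_value z u))
    (Hs : search_process e u s)
    (Hobs : observation e s Omega obs) :
  let M := merged Omega obs in
  let r := recast M obs s in
  optimal_process e u s ->
  (forall (j t : nat) (a b : raction T), (0 < t)%N ->
     onth r j = Some a -> onth r (j + t)%N = Some b ->
     rfeasible M r j b -> outranks z u a b) /\
  (forall abar : raction T, preventive z u M r abar ->
     forall b : raction T, unselected M r b -> outranks z u abar b).
Proof.
move=> M r Hopt.
have us : uniq s := uniq_process He Hindep Hinv Hs.
have ur : uniq r by exact: uniq_recast.
have [Os _ obs_in] := Hobs; have {}obs_in a : obs a -> a \in s by exact: obs_in.
have stepI := step_inspect He Hindep Hinv Hz Hties Hs Hopt.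
have stepP := step_purchase He Hindep Hinv Hz Hties Hs Hopt.
have stepC := step_composite He Hindep Hinv Hz Hties Hs Hopt.
have precIP := inspect_precedes_purchase He Hindep Hinv Hs.
have inP k : Purchase k \in s -> Inspect k \in s.
  move=> Ps; rewrite -index_mem (ltn_trans (precIP _ Ps))//.
  by rewrite index_mem.
have InM k l : M k -> ~~ M l -> Inspect l != Inspect k :> action T.
  by move=> Mk; apply: contra => /eqP[->].
split.
- move=> j t a b t0 ja jb fb.
  have [ar ia] := onth_index ur ja; have [br ib] := onth_index ur jb.
  have prec : precedes s (selection a) (selection b).
    by apply: (@recast_precedes _ M obs) => //; rewrite ia ib -addn1 leq_add2l.
  have nprec : ~~ precedes s (selection b) (selection a).
    by rewrite /precedes -leqNgt ltnW.
  have ab : selection a != selection b.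
    by apply: contraTN prec => /eqP ->; rewrite /precedes ltnn.
  have sb : selection b \in s by move: br; rewrite mem_recast => /and3P[].
  have sa : selection a \in s by move: ar; rewrite mem_recast => /and3P[].
  (* A purchase ends the process, so only an inspection can be followed by [b]. *)
  have [i ei] : exists i, a = Single (Inspect i).
    case: a {ja ar ia fb prec} nprec ab sa => [[i|k]|k] nprec ab sa;
      first (by exists i);
      by case/negP: nprec; apply: (purchase_last Hs) => //; rewrite eq_sym.
  rewrite {}ei /= in ab sa prec nprec ar ia ja *.
  have Mi : ~~ M i by move: ar; rewrite recast_inspect => /and3P[].
  rewrite /outranks /=.
  case: b br sb nprec ab fb {ib jb prec} => [[l|l]|l] br sb nprec ab fb /=.
  - exact: (stepI _ _ sa).
  - apply: (stepP _ _ sa) => //; case/and3P: fb => _ lj _.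
    have lr := mem_take lj.
    apply: (@recast_precedes _ M obs s (Single (Inspect l)) (Single (Inspect i))) => //.
    by rewrite ia -in_take.
  - apply: (stepC _ _ sa) => //; apply: InM => //.
    by case/andP: fb.
- move=> abar [[j0 jabar nacc] _] b [[j jr fb] bNr].
  have [abr iab] := onth_index ur jabar.
  have access x : x \in r -> x != abar -> rfeasible M r j0 x -> False.
    by move=> xr xa fx; apply: nacc; apply: (accessible_index ur jabar xr).
  have sA : selection abar \in s by move: abr; rewrite mem_recast => /and3P[].
  have oA : obs (selection abar) by move: abr; rewrite mem_recast => /and3P[].
  have inspected_parent k : abar = Composite k -> Inspect k \in s /\ M k.
    by move=> ea; move: abr; rewrite ea recast_composite => /and3P[_ /inP].
  (* The value of a composite [abar] is a minimum, so [v] must also lie below [z k]; that comparison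
     is made at the step of the parent in [s], although the parent is absent from [r]. *)
  have outrank v : v < action_value z u (selection abar) ->
      (forall k, abar = Composite k -> v < z k) -> v < raction_value z u abar.
    case: abar {jabar abr iab access sA oA inspected_parent} => [a|k] //= vu vz.
    by rewrite lt_min vu vz.
  rewrite /outranks; case: b fb bNr => [[l|l]|l] fb bNr /=.
  - have Ml : ~~ M l by case/andP: fb.
    have oNl : ~~ obs (Inspect l).
      by apply: contra bNr => ol; rewrite recast_inspect ol Ml obs_in.
    (* As [l] is unmerged but its inspection is unobserved, only the second alternative of
       [determined] is left. *)
    have nprec a : obs a -> ~~ precedes s (Inspect l) a.
      move=> oa; have [[ol _]|] := unmerged_determined Ml oa; last exact.
      by rewrite ol in oNl.
    apply: outrank => [|k ek].
      apply: (stepI _ _ sA) (nprec _ oA).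
      by apply: contra oNl => /eqP <-.
    have [sk Mk] := inspected_parent _ ek.
    apply: (stepI _ _ sk); first by rewrite eq_sym InM.
    apply: contra (nprec _ oA) => lk; apply: precedes_trans lk _.
    by rewrite ek; apply: precIP; move: sA; rewrite ek.
  - have [Ml lj _] := and3P fb.
    have oNl : ~~ obs (Purchase l).
      by apply: contra bNr => ol; rewrite recast_purchase ol Ml obs_in.
    have lr := mem_take lj.
    have sl : Inspect l \in s by move: lr; rewrite recast_inspect => /and3P[].
    have selA : selection abar != Purchase l.
      by apply: contra oNl => /eqP <-.
    (* Were [abar] the inspection of [l], the action selected at [j], or else
       its parent, would be feasible at [j0] and selected later. *)
    have al : abar != Single (Inspect l).
      apply/negP => /eqP al.
      have j0j : (j0 < j)%N by move: lj; rewrite in_take// -al iab.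
      have [x jx] : exists x, onth r j = Some x.
        by move: jr; rewrite -onthTE; case: onth => // x; exists x.
      have [xr ix] := onth_index ur jx.
      have xa : x != abar by apply: contraTN j0j => /eqP xa; rewrite -ix -iab xa ltnn.
      have xNt : x \notin take j0 r by rewrite in_take// ix -leqNgt ltnW.
      have := access x xr xa.
      case: x {jx ix} xr xa xNt => [[i|k]|k] xr xa xNt.
      + by move: (xr); rewrite recast_inspect /= => /and3P[_ _ ->]; rewrite xNt; exact.
      + move: (xr); rewrite recast_purchase /= => /and3P[ok sk Mk].
        rewrite Mk xNt andbT /= => acc.
        (* An observed purchase of an unmerged product has an observed inspection: the second
           alternative of [determined] fails in [s] itself. *)
        have okI : obs (Inspect k).
          have [[]//|/(_ s Os)] := unmerged_determined Mk ok.
          by rewrite precIP.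
        have kr : Single (Inspect k) \in r by rewrite recast_inspect okI Mk inP.
        apply: (access _ kr) => /=.
          by rewrite al; apply: contra oNl => /eqP[<-].
        by rewrite Mk; apply/negP.
      + by move: (xr); rewrite recast_composite /= => /and3P[_ _ ->]; rewrite xNt; exact.
    (* Otherwise the inspection of [l] would be feasible at [j0] and selected later. *)
    have lj0 : Single (Inspect l) \in take j0 r.
      apply: contraT => lNj0; case: (access _ lr); first by rewrite eq_sym.
      by rewrite /= Ml.
    have prec : precedes s (Inspect l) (selection abar).
      apply: (@recast_precedes _ M obs s (Single (Inspect l))) => //.
      by rewrite iab -in_take.
    apply: outrank => [|k ek]; first exact: (stepP _ _ sA).
    have [sk Mk] := inspected_parent _ ek.
    (* If [k] is inspected before [l], then [u l < u k < z l < z k]: the purchase of [k] was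
       declined when [l] was inspected, and the inspection of [l] when [k] was. *)
    have [lk|nlk] := boolP (precedes s (Inspect l) (Inspect k)).
      exact: (stepP _ _ sk).
    have lNk := InM _ _ Mk Ml.
    have zlk : z l < z k by apply: (stepI _ _ sk) => //; rewrite eq_sym.
    have ulk : u l < u k by have := stepP _ l sA selA prec; rewrite ek.
    have ukl : u k < z l.
      by apply: (stepP _ k sl) => //; apply: precedes_total nlk.
    exact: lt_trans ulk (lt_trans ukl zlk).
  - have Ml : M l by case/andP: fb.
    have oNl : ~~ obs (Purchase l).
      by apply: contra bNr => ol; rewrite recast_composite ol Ml obs_in.
    apply: outrank => [|k ek].
      apply: (stepC _ _ sA); last by apply: contra oNl => /eqP <-.
      case: abar abr {jabar iab access sA oA inspected_parent} => [[i|i]|i]//=.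
      by rewrite recast_inspect => /and3P[_ _ /(InM _ _ Ml)].
    have [sk Mk] := inspected_parent _ ek.
    apply: (stepC _ _ sk) => //; apply: contra oNl => /eqP[<-].
    by move: oA; rewrite ek.
Qed.
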